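(* There exists a function $K'(l,n)=O(n^3l^2)$ such that the following holds. Let $B$ (blue) and $R$ (red) be disjoint finite point sets in the plane with $B\cup R$ in general position (no three collinear), $|R|=l\geq 1$, all red points in the interior of $\mathrm{Conv}(B)$, $\mathrm{Conv}(B)$ having $n$ vertices, and $|B|=n+k$ where $k$ is the number of blue points in the interior of $\mathrm{Conv}(B)$. If $k\geq K'(l,n)$, then there exists a simple polygon whose vertex set is a subset of $B$ of size at most $2n$ that contains all $n$ vertices of $\mathrm{Conv}(B)$, and such that every red point lies in the exterior of this polygon.
   Context: $\mathrm{Conv}(X)$ denotes the convex hull of $X$. *)

(* Defs.v *)
From HB Require Import structures.
From mathcomp Require Import all_boot all_order all_algebra.
From mathcomp Require Import all_classical all_reals all_analysis.

Set Implicit Arguments.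
Unset Strict Implicit.
Unset Printing Implicit Defensive.

Import Order.TTheory GRing.Theory Num.Theory.
Import numFieldNormedType.Exports.
Local Open Scope classical_set_scope.
Local Open Scope ring_scope.

Section PlaneGeometry.
Variable R : realType.
Local Notation point := (R * R)%type.
Implicit Types (A : set point) (a b x : point) (p : seq point).

Definition collinear a b c :=
  exists u v w : R, (u, v) != (0, 0) /\
    forall z : point, z \in [:: a; b; c] -> u * z.1 + v * z.2 = w.

Definition general_position A :=
  forall a b c, A a -> A b -> A c -> uniq [:: a; b; c] -> ~ collinear a b c.

Definition conv_hull A : set point := smallest (@convex_set R point) A.

(* The vertices of a convex polygon are its extreme points. *)
Definition extreme_points A : set point :=
  [set x | A x /\ forall a b (t : R), A a -> A b -> 0 < t < 1 ->
             x = (1 - t) *: a + t *: b -> a = x /\ b = x].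

Definition segment a b : set point :=
  [set (1 - t) *: a + t *: b | t in `[0, 1]].

(* A polygon is given by the cyclic sequence p of its vertices; its i-th edge
   joins p_i to p_(i+1), indices being taken modulo size p. *)
Definition edge_start p (i : nat) : point := nth 0 p i.
Definition edge_end p (i : nat) : point := nth 0 p (i.+1 %% size p).

Definition edge p (i : nat) : set point :=
  segment (edge_start p i) (edge_end p i).

Definition polygon_curve p : set point :=
  \bigcup_(i in [set i : nat | (i < size p)%N]) edge p i.

(* The vertices are pairwise distinct and two distinct edges meet at most in
   a common endpoint: consecutive edges meet only in the vertex they share and
   non-consecutive edges are disjoint. *)
Definition simple_polygon p :=
  [/\ (3 <= size p)%N,
      uniq p &
      forall i j : nat, (i < size p)%N -> (j < size p)%N -> i != j ->
        edge p i `&` edge p j `<=`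
          [set edge_start p i; edge_end p i] `&`
          [set edge_start p j; edge_end p j]].

(* The unbounded component of the complement of the polygonal curve. A point of
   the curve is excluded, as its connected_component is then set0. *)
Definition exterior p : set point :=
  [set x | ~ bounded_set (connected_component (~` polygon_curve p) x)].

End PlaneGeometry.

(* Main.v *)
(** List the vertices of the hull counterclockwise as [v_0, ..., v_(n-1)].  The
    [n l] lines through a hull vertex and a red point cut the plane into at most
    [(n l)^2 + 1] cells, so one cell contains [n] of the inner blue points.
    Match these points [w_i] with the hull edges [v_i v_(i+1)] so that the product
    of the areas of the triangles [T_i = w_i v_i v_(i+1)] is minimal.  Exchanging
    two of the points cannot decrease the product, and this says exactly that
    some line through the intersection of the lines supporting two hull edges
    separates the corresponding triangles; hence distinct [T_i] meet at most in a
    common hull vertex, and [v_0 w_0 v_1 w_1 ...] is a simple polygon.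
    For a red point [r] the side of the line [v_i r] on which the cell lies changes
    from left to right somewhere as [i] runs around the hull, which puts [r] in
    [T_i]; the ray from [r] away from [w_i] then escapes to infinity. *)
Require Import Defs.
From HB Require Import structures.
From mathcomp Require Import all_boot all_order all_algebra fingroup perm.
From mathcomp Require Import all_classical all_reals all_analysis.
From mathcomp Require Import ring lra zify.

Set Implicit Arguments.
Unset Strict Implicit.
Unset Printing Implicit Defensive.

Import Order.TTheory GRing.Theory Num.Theory.
Import numFieldNormedType.Exports.
Local Open Scope classical_set_scope.
Local Open Scope card_scope.

(** * Orientation and convex hulls *)

Section Orientation.
Local Open Scope ring_scope.
Variable R : realType.
Local Notation point := (R * R)%type.
Implicit Types (a b c x y z : point).

Lemma add_fst x y : (x + y).1 = x.1 + y.1. Proof. by []. Qed.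
Lemma add_snd x y : (x + y).2 = x.2 + y.2. Proof. by []. Qed.
Lemma scale_fst (t : R) x : (t *: x).1 = t * x.1. Proof. by []. Qed.
Lemma scale_snd (t : R) x : (t *: x).2 = t * x.2. Proof. by []. Qed.
Definition coordE := (add_fst, add_snd, scale_fst, scale_snd).

(** Twice the signed area of the triangle [a b c], positive when [c] lies to the left of the line
    from [a] to [b]. *)
Definition orient a b c : R :=
  (b.1 - a.1) * (c.2 - a.2) - (b.2 - a.2) * (c.1 - a.1).

Lemma orient_rot a b c : orient a b c = orient b c a.
Proof. rewrite /orient; ring. Qed.

Lemma orient_swap a b c : orient a b c = - orient b a c.
Proof. rewrite /orient; ring. Qed.

Lemma orient_swapr a b c : orient a b c = - orient a c b.
Proof. rewrite /orient; ring. Qed.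

Lemma orient_baa a b : orient a b a = 0.
Proof. rewrite /orient; ring. Qed.

Lemma orient_bab a b : orient a b b = 0.
Proof. rewrite /orient; ring. Qed.

Lemma orient_comb (s t u : R) a b x y z : s + t + u = 1 ->
  orient a b (s *: x + t *: y + u *: z) =
  s * orient a b x + t * orient a b y + u * orient a b z.
Proof.
move=> stu; have -> : s = 1 - t - u by lra.
rewrite /orient !coordE; ring.
Qed.

Lemma orient_comb2 (s t : R) a b x y : s + t = 1 ->
  orient a b (s *: x + t *: y) = s * orient a b x + t * orient a b y.
Proof.
move=> st; have -> : s = 1 - t by lra.
rewrite /orient !coordE; ring.
Qed.

Lemma point_eq x y : x.1 = y.1 -> x.2 = y.2 -> x = y.
Proof. by case: x y => [? ?] [? ?] /= -> ->. Qed.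

Lemma collinear_orient0 a b c :
  a != b -> orient a b c = 0 -> collinear a b c.
Proof.
move=> ab abc0.
exists (a.2 - b.2), (b.1 - a.1), (a.2 * b.1 - a.1 * b.2); split.
  apply: contraNN ab => /eqP[/eqP + /eqP]; rewrite !subr_eq0 => /eqP e2 /eqP e1.
  by apply/eqP/point_eq.
move: abc0; rewrite /orient => abc0.
move=> z; rewrite !inE => /or3P[]/eqP->; lra.
Qed.

Lemma general_position_orient (A : set point) a b c : general_position A ->
  A a -> A b -> A c -> a != b -> a != c -> b != c -> orient a b c != 0.
Proof.
move=> gA Aa Ab Ac ab ac bc; apply/eqP => /(collinear_orient0 ab).
by apply: (gA a b c) => //=; rewrite !inE negb_or ab ac bc.
Qed.

(** Cramer's rule: after clearing the denominator, the identity is polynomial in the coordinates. *)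
Lemma barycentric a b c x : orient a b c != 0 ->
  x = (orient b c x / orient a b c) *: a + (orient c a x / orient a b c) *: b
      + (orient a b x / orient a b c) *: c.
Proof.
move=> d0.
suff: orient a b c *: x = orient b c x *: a + orient c a x *: b + orient a b x *: c.
  move=> e; apply: (scalerI d0); rewrite e !scalerDr !scalerA.
  by rewrite ![orient a b c * (_ / _)]mulrC !divfK.
apply: point_eq; rewrite /orient !coordE; ring.
Qed.

Lemma orient_sum a b c x :
  orient b c x + orient c a x + orient a b x = orient a b c.
Proof. rewrite /orient; ring. Qed.

Lemma conv_hull_convex (A : set point) x y (t : R) :
  conv_hull A x -> conv_hull A y -> 0 <= t <= 1 ->
  conv_hull A ((1 - t) *: x + t *: y).
Proof.
move=> Ax Ay /andP[t0 t1] M [Mc AM].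
have t1' : 0 <= 1 - t by rewrite subr_ge0.
have t0' : 1 - t <= 1 by rewrite lerBlDr lerDl.
(* The library combination [conv] puts its parameter on the first point, hence the value [1 - t]. *)
have := Mc x y (Itv01 t1' t0').
rewrite !inE => /(_ (Ax M (conj Mc AM)) (Ay M (conj Mc AM))).
have -> // : conv (Itv01 t1' t0') (x : convex_lmodType point) y =
  (1 - t) *: x + t *: y.
have -> : conv (Itv01 t1' t0') (x : convex_lmodType point) y =
  (1 - t) *: x + (1 - (1 - t)) *: y by [].
by rewrite subKr.
Qed.

Lemma conv_hull_orient_ge0 (A : set point) a b x :
  (forall y, A y -> 0 <= orient a b y) -> conv_hull A x -> 0 <= orient a b x.
Proof.
move=> A0; suff: conv_hull A `<=` [set y | 0 <= orient a b y] by apply.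
apply: smallest_sub => // y z t; rewrite !inE /= => y0 z0.
have -> : conv t (y : convex_lmodType point) z =
  t%:num *: y + (1 - t%:num) *: z by [].
rewrite orient_comb2 ?subrKC//.
by rewrite addr_ge0// mulr_ge0// subr_ge0.
Qed.
End Orientation.

(** * Cells of a line arrangement *)

(** Used to replace a list of sign vectors by points realizing them, so that these points can be
    counted instead. *)
Lemma seq_choice (T U : eqType) (f : T -> U) (D : T -> Prop) (us : seq U) :
  (forall u, u \in us -> exists2 x, D x & f x = u) ->
  exists2 Q : seq T, (forall x, x \in Q -> D x) & map f Q = us.
Proof.
elim: us => [|u us IH] H; first by exists [::].
have [x Dx fx] := H u (mem_head _ _).
have [v vus|Q DQ <-] := IH; first by apply: H; rewrite inE vus orbT.
by exists (x :: Q); rewrite /= ?fx// => y; rewrite inE => /predU1P[->//|/DQ].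
Qed.

(** The counting step for line arrangements: a new line adds one cell for each old cell with points
    on both of its sides. It is inclusion-exclusion for the values of [f] on the two classes of
    [h]. *)
Lemma undup_pair_bound (T U : eqType) (h : T -> bool) (f : T -> seq U)
    (g : bool -> U) (P : seq T) :
  size (undup [seq g (h x) :: f x | x <- P]) <= size (undup (map f P)) +
    size [seq u <- undup (map f (seq.filter (predC h) P)) |
            u \in map f (seq.filter h P)].
Proof.
set A1 := map f (seq.filter h P); set A0 := map f (seq.filter (predC h) P).
have -> : size (undup (map f P)) = size (undup (A0 ++ A1)).
  apply/perm_size/uniq_perm; rewrite ?undup_uniq// => u; rewrite !mem_undup.
  rewrite -map_cat; apply: eq_mem_map => x.
  by rewrite mem_cat !mem_filter /= -andb_orl orNb.
have -> : size (undup (A0 ++ A1)) + size [seq u <- undup A0 | u \in A1] =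
    size (undup A0) + size (undup A1).
  rewrite undup_cat size_cat !size_filter addnAC; congr addn.
  by rewrite addnC; exact: count_predC.
have <- : size [seq g false :: u | u <- undup A0] = size (undup A0).
  by rewrite size_map.
have <- : size [seq g true :: u | u <- undup A1] = size (undup A1).
  by rewrite size_map.
rewrite -size_cat; apply: uniq_leq_size; first exact: undup_uniq.
move=> c; rewrite mem_undup => /mapP[x xP ->]; rewrite mem_cat; apply/orP.
case: (boolP (h x)) => hx; [right|left]; apply/mapP; exists (f x) => //;
  by rewrite mem_undup; apply/mapP; exists x => //; rewrite mem_filter /= hx.
Qed.

Lemma size_sum_fibers (T : Type) (U : eqType) (f : T -> U) (P : seq T)
    (us : seq U) : uniq us -> all (fun x => f x \in us) P ->
  size P = \sum_(u <- us) count (fun x => f x == u) P.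
Proof.
move=> Uus; elim: P => [_|x P IH] /=; first by rewrite big1.
move=> /andP[fx /IH->]; rewrite big_split /= -add1n; congr addn.
rewrite (bigD1_seq (f x))//= eqxx big1 ?addn0// => u.
by rewrite eq_sym => /negPf->.
Qed.

Lemma pigeonhole_fiber (T : eqType) (U : eqType) (f : T -> U) (P : seq T) n m :
  0 < n -> 0 < m -> size (undup (map f P)) <= m -> n * m <= size P ->
  exists u, n <= count (fun x => f x == u) P.
Proof.
move=> n0 m0 Um nmP; apply: contrapT => /forallNP H.
suff: size P <= n.-1 * m by nia.
rewrite (@size_sum_fibers _ _ f _ _ (undup_uniq (map f P))); last first.
  by apply/allP => x xP; rewrite mem_undup map_f.
apply: leq_trans (leq_mul (leqnn _) Um).
rewrite -sum1_size big_distrr /=; apply: leq_sum => u _.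
by have := H u; lia.
Qed.

Section Cells.
Local Open Scope ring_scope.
Variable R : realType.
Local Notation point := (R * R)%type.
Implicit Types (L : point * point) (s : seq (point * point)) (P : seq point).

Definition side L (x : point) : R := orient L.1 L.2 x.

(** For a point on none of the lines, this vector names its cell. *)
Definition side_signs s (x : point) : seq bool := [seq 0 < side L x | L <- s].

Definition off_lines s P :=
  forall L x, L \in s -> x \in P -> side L x != 0.

(** If an old cell has points on both sides of [L], the segment joining two of them stays in the
    cell by convexity and crosses [L]. The crossing point shows that split cells correspond to cells
    traced on [L]. *)
Lemma side_signs_split L s P u : off_lines (L :: s) P ->
  u \in [seq u <- undup (map (side_signs s)
                            (seq.filter (predC (fun x => 0 < side L x)) P)) |
           u \in map (side_signs s) (seq.filter (fun x => 0 < side L x) P)] ->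
  exists p q x, [/\ p \in P, q \in P, side L q < 0 < side L p & 
    [/\ side L x = 0, exists2 t, 0 <= t <= 1 & x = (1 - t) *: p + t *: q,
    forall M, M \in s -> side M x != 0 & side_signs s x = u]].
Proof.
move=> off.
rewrite mem_filter mem_undup => /andP[/mapP[p + ->]].
rewrite mem_filter => /andP[Lp pP] /mapP[q]; rewrite mem_filter /= => /andP[+ qP] epq.
rewrite -leNgt le_eqVlt (negPf (off L q _ _)) ?mem_head//= => Lq.
pose t := side L p / (side L p - side L q).
have d0 : 0 < side L p - side L q by lra.
have t01 : 0 <= t <= 1.
  by rewrite divr_ge0 ?(ltW Lp) ?(ltW d0)//= ler_pdivrMr// mul1r; lra.
have sgnx M : M \in s -> 0 < side M ((1 - t) *: p + t *: q) = (0 < side M p)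
    /\ side M ((1 - t) *: p + t *: q) != 0.
  move=> Ms.
  have e : (0 < side M p) = (0 < side M q).
    have := congr1 (fun l => nth false l (index M s)) epq.
    by rewrite /side_signs !(nth_map M) ?index_mem// nth_index.
  have Mp := off M p; have Mq := off M q; rewrite !inE Ms orbT in Mp Mq.
  move: (Mp isT pP) (Mq isT qP) => {}Mp {}Mq.
  rewrite /side orient_comb2 ?subrK// -/(side M p) -/(side M q).
  case: (ltrgtP 0 (side M p)) e Mp => [p0 /esym q0|p0 /esym/negbT|<-]; rewrite ?eqxx//.
    have : 0 < (1 - t) * side M p + t * side M q by nra.
    by move=> xx; rewrite xx gt_eqF.
  rewrite -leNgt le_eqVlt (negPf Mq) /= => q0.
  have : (1 - t) * side M p + t * side M q < 0 by nra.
  by move=> xx; rewrite lt_eqF// ltNge (ltW xx).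
exists p, q, ((1 - t) *: p + t *: q); split => //; first by rewrite Lq Lp.
split.
- rewrite /side orient_comb2 ?subrK// -/(side L p) -/(side L q) /t.
  by field; rewrite gt_eqF.
- by exists t.
- by move=> M /sgnx[].
- by apply/eq_in_map => M /sgnx[].
Qed.

(** The vectors [x - x'] and [y - z] are both parallel to [L], hence to each other. The linear part
    of [side M] vanishes on the first and not on the second, so the first is zero. *)
Lemma common_zero_unique L M x x' y z : L.1 != L.2 ->
  side L x = 0 -> side L x' = 0 -> side L y = 0 -> side L z = 0 ->
  side M x = 0 -> side M x' = 0 -> side M z < 0 < side M y -> x = x'.
Proof.
case: L M => [a b] [c d]; rewrite /side /= => ab lx lx' ly lz mx mx' /andP[mz my].
pose d1 := x.1 - x'.1; pose d2 := x.2 - x'.2.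
pose e1 := y.1 - z.1; pose e2 := y.2 - z.2.
pose u := a.2 - b.2; pose v := b.1 - a.1.
have ud : u * d1 + v * d2 = 0.
  have -> : u * d1 + v * d2 = orient a b x - orient a b x'.
    by rewrite /u /v /d1 /d2 /orient; ring.
  by rewrite lx lx' subrr.
have ue : u * e1 + v * e2 = 0.
  have -> : u * e1 + v * e2 = orient a b y - orient a b z.
    by rewrite /u /v /e1 /e2 /orient; ring.
  by rewrite ly lz subrr.
have de : d1 * e2 = d2 * e1.
  have [u0|u0] := eqVneq u 0.
    have v0 : v != 0.
      apply: contraNneq ab => v0; apply/eqP/point_eq.
        by apply/esym/eqP; rewrite -subr_eq0 -/v v0.
      by apply/eqP; rewrite -subr_eq0 -/u u0.
    apply: (mulfI v0); move: ud ue; rewrite u0 !mul0r !add0r.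
    move=> /eqP; rewrite mulf_eq0 (negPf v0) /= => /eqP->.
    by move=> /eqP; rewrite mulf_eq0 (negPf v0) /= => /eqP->; rewrite mulr0 mul0r.
  apply: (mulfI u0).
  have -> : u * (d1 * e2) = (u * d1 + v * d2) * e2 - d2 * (v * e2) by ring.
  have -> : v * e2 = - (u * e1) by lra.
  by rewrite ud; ring.
pose m := c.2 - d.2; pose n := d.1 - c.1.
have md : m * d1 + n * d2 = 0.
  have -> : m * d1 + n * d2 = orient c d x - orient c d x'.
    by rewrite /m /n /d1 /d2 /orient; ring.
  by rewrite mx mx' subrr.
have me : 0 < m * e1 + n * e2.
  have -> : m * e1 + n * e2 = orient c d y - orient c d z.
    by rewrite /m /n /e1 /e2 /orient; ring.
  by lra.
have k1 : d1 * (m * e1 + n * e2) = 0.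
  have -> : d1 * (m * e1 + n * e2) =
    (m * d1 + n * d2) * e1 + n * (d1 * e2 - d2 * e1) by ring.
  by rewrite md de; ring.
have k2 : d2 * (m * e1 + n * e2) = 0.
  have -> : d2 * (m * e1 + n * e2) =
    (m * d1 + n * d2) * e2 - m * (d1 * e2 - d2 * e1) by ring.
  by rewrite md de; ring.
by apply: point_eq; apply/eqP; rewrite -subr_eq0; apply/eqP;
  apply: (mulIf (lt0r_neq0 me)); rewrite mul0r.
Qed.

(** Along [L], a further line [M] splits at most one cell: two split cells would give two distinct
    common points of [L] and [M]. *)
Lemma cells_on_line L s P : L.1 != L.2 -> off_lines s P ->
  (forall x, x \in P -> side L x = 0) ->
  (size (undup (map (side_signs s) P)) <= (size s).+1)%N.
Proof.
move=> ab + PL; elim: s => [|M s IH] off.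
  apply: (@uniq_leq_size _ _ [:: [::]]); first exact: undup_uniq.
  by move=> c; rewrite mem_undup => /mapP[x _ ->]; rewrite inE.
have offs : off_lines s P by move=> K x Ks; apply: off; rewrite inE Ks orbT.
apply: leq_trans (undup_pair_bound (fun x => 0 < side M x) (side_signs s) id P) _.
rewrite /= -addn1; apply: leq_add; first exact: IH.
set us := [seq _ <- _ | _].
have [|Q QD Qus] := @seq_choice _ _ (side_signs s)
    (fun x => [/\ side L x = 0, side M x = 0 & exists y z,
       [/\ side L y = 0, side L z = 0 & side M z < 0 < side M y]]) us.
  move=> u /(side_signs_split off)[p [q [x [pP qP pq [Mx [t t01 xE] _ sx]]]]].
  exists x => //; split => //; last by exists p, q; rewrite !PL.
  by rewrite xE /side orient_comb2 ?subrK// -!/(side L _) !PL//; ring.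
have : uniq us by rewrite filter_uniq ?undup_uniq.
rewrite -Qus; case: Q QD {Qus} => [//|x [//|x' Q]] QD /andP[/=].
rewrite inE negb_or => /andP[].
have [Lx Mx [y [z [Ly Lz Myz]]]] := QD x (mem_head _ _).
have [|Lx' Mx' _] := QD x'; first by rewrite !inE eqxx orbT.
by rewrite (common_zero_unique ab Lx Lx' Ly Lz Mx Mx' Myz) eqxx.
Qed.

(** With [m] lines present, a new one splits at most [m + 1] cells, the number of cells traced on
    it, and [(m^2 + 1) + (m + 1) <= (m + 1)^2 + 1]. *)
Lemma cells_in_plane s P : off_lines s P ->
  (size (undup (map (side_signs s) P)) <= size s ^ 2 + 1)%N.
Proof.
elim: s => [|L s IH] off.
  apply: (@uniq_leq_size _ _ [:: [::]]); first exact: undup_uniq.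
  by move=> c; rewrite mem_undup => /mapP[x _ ->]; rewrite inE.
have offs : off_lines s P by move=> K x Ks; apply: off; rewrite inE Ks orbT.
apply: leq_trans (undup_pair_bound (fun x => 0 < side L x) (side_signs s) id P) _.
set us := [seq _ <- _ | _].
suff: (size us <= (size s).+1)%N by have := IH offs; rewrite /= -!mulnn => *; nia.
have usU : uniq us by rewrite filter_uniq ?undup_uniq.
have [|Q QD Qus] := @seq_choice _ _ (side_signs s)
    (fun x => [/\ side L x = 0, forall M, M \in s -> side M x != 0 & L.1 != L.2]) us.
  move=> u /(side_signs_split off)[p [q [x [pP qP /andP[_ Lp] [Lx _ xs sx]]]]].
  (* If [L] had equal ends, [side L] would vanish everywhere, against [0 < side L p]. *)
  exists x => //; split => //; apply: contraTneq Lp; rewrite /side => ->.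
  by rewrite -orient_rot orient_bab ltxx.
case: Q QD Qus => [|x Q] QD Qus; first by rewrite -Qus.
rewrite -(undup_id usU) -Qus; apply: (@cells_on_line L).
- by have [] := QD x (mem_head _ _).
- by move=> M y Ms /QD[_ /(_ M Ms)].
- by move=> y /QD[].
Qed.

Lemma many_in_one_cell s P n : off_lines s P ->
  (n * (size s ^ 2 + 1) <= size P)%N ->
  exists Q, [/\ subseq Q P, size Q = n &
    forall L x y, L \in s -> x \in Q -> y \in Q ->
      (0 < side L x) = (0 < side L y)].
Proof.
move=> off nP; case: n nP => [|n] nP; first by exists [::]; rewrite sub0seq.
have [] := pigeonhole_fiber _ _ (cells_in_plane off) nP => // [|u nu].
  by rewrite addn1.
exists (take n.+1 [seq x <- P | side_signs s x == u]); split.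
- exact: subseq_trans (take_subseq _ _) (filter_subseq _ _).
- by rewrite size_takel// size_filter.
- move=> L x y Ls /mem_take + /mem_take.
  rewrite !mem_filter => /andP[/eqP ux _] /andP[/eqP uy _].
  have := congr1 (fun l => nth false l (index L s)) (etrans ux (esym uy)).
  by rewrite /side_signs !(nth_map L) ?index_mem// nth_index.
Qed.
End Cells.

(** * The convex hull as a cyclic sequence *)

Section Hull.
Local Open Scope ring_scope.
Variable R : realType.
Local Notation point := (R * R)%type.
Implicit Types (u v x y z : point) (s B : seq point).

Lemma seq_argmax (T : eqType) (f : T -> R) (s : seq T) (x : T) : x \in s ->
  exists2 u : T, u \in s & forall y : T, y \in s -> f y <= f u.
Proof.
elim: s x => // x [_ _ _|y s IH _ _].
  by exists x; rewrite ?mem_head// => z; rewrite inE => /eqP->.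
have [u us Hu] := IH y (mem_head _ _).
have [xu|ux] := leP (f x) (f u).
  exists u; rewrite ?(in_cons x) ?us ?orbT// => z.
  by rewrite in_cons => /predU1P[->//|/Hu].
exists x; first exact: mem_head.
move=> z; rewrite in_cons => /predU1P[->//|/Hu zu].
exact: le_trans zu (ltW ux).
Qed.

(* A linear form positive on the vectors [x - u] makes [orient u] a strict order. *)
Lemma angular_min (p q : R) u s x :
  (forall y, y \in s -> 0 < p * (y.1 - u.1) + q * (y.2 - u.2)) ->
  (forall y z, y \in s -> z \in s -> y != z -> orient u y z != 0) ->
  x \in s -> exists2 y, y \in s & forall z, z \in s -> z != y -> 0 < orient u y z.
Proof.
elim: s x => // x [_ _ _ _ _|x' s IH _ pos gen _].
  by exists x; rewrite ?mem_head// => z; rewrite inE => ->.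
have [||y ys Hy] := IH x' _ _ (mem_head _ _).
- by move=> y ys; apply: pos; rewrite in_cons ys orbT.
- by move=> y z ys zs; apply: gen; rewrite in_cons ?ys ?zs orbT.
have y's : y \in x :: x' :: s by rewrite in_cons ys orbT.
have [->|xy] := eqVneq x y.
  exists y; rewrite ?mem_head// => z; rewrite in_cons => /predU1P[->|/Hy//].
  by rewrite eqxx.
have := gen x y (mem_head _ _) y's xy; rewrite neq_lt => /orP[lt0|gt0].
  exists y => // z; rewrite in_cons => /predU1P[-> _|/Hy//].
  by rewrite orient_swapr oppr_gt0.
exists x; first exact: mem_head.
move=> z; rewrite in_cons => /predU1P[->|zs _]; first by rewrite eqxx.
have [->//|zy] := eqVneq z y.
have gx := pos x (mem_head _ _); have gy := pos y y's.
have gz : 0 < p * (z.1 - u.1) + q * (z.2 - u.2) by apply: pos; rewrite in_cons zs orbT.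
have := Hy z zs zy => yz.
(* Transitivity of the angular order: the vectors from [u] to [x], [y], [z] satisfy a linear
   relation with orientations as coefficients, to which the positive linear form is applied. *)
rewrite -(pmulr_rgt0 _ gy).
have -> : (p * (y.1 - u.1) + q * (y.2 - u.2)) * orient u x z =
  (p * (x.1 - u.1) + q * (x.2 - u.2)) * orient u y z +
  (p * (z.1 - u.1) + q * (z.2 - u.2)) * orient u x y by rewrite /orient; ring.
by rewrite addr_gt0// mulr_gt0.
Qed.

Definition hull_edge B v u :=
  [&& v \in B, u \in B, v != u &
      all (fun x => [|| x == v, x == u | 0 < orient v u x]) B].

Lemma hull_edge_orient B v u x : hull_edge B v u -> x \in B -> x != v ->
  x != u -> 0 < orient v u x.
Proof.
by case/and4P=> _ _ _ /allP H /H; case/or3P => [/eqP->|/eqP->|//]; rewrite eqxx.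
Qed.

Variable B : seq point.
Hypothesis uniqB : uniq B.
Hypothesis size_B : (3 <= size B)%N.
Hypothesis genB : forall x y z, x \in B -> y \in B -> z \in B ->
  x != y -> x != z -> y != z -> orient x y z != 0.

Lemma third_point v u : exists x, [/\ x \in B, x != v & x != u].
Proof.
have : ~~ all (fun x => x \in [:: v; u]) B.
  apply: contraTN size_B => /allP sub; rewrite -ltnNge ltnS.
  exact: (@uniq_leq_size _ _ [:: v; u] uniqB sub).
by case/allPn => x xB; rewrite !inE negb_or => /andP[xv xu]; exists x.
Qed.

(** The point [u] of [B] farthest from the origin is a hull vertex: the scalar product of [- u] with
    [x - u] is positive for every other [x]. The angular minimum around [u] then ends an edge. *)
Lemma first_hull_edge : exists v u, hull_edge B v u.
Proof.
have [x [xB _ _]] := third_point 0 0.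
have [u uB Hu] := seq_argmax (fun x : point => x.1 ^+ 2 + x.2 ^+ 2) xB.
have [y [yB yu _]] := third_point u u.
have [|||z] := @angular_min (- u.1) (- u.2) u [seq x <- B | x != u] y.
- move=> z; rewrite mem_filter => /andP[zu /Hu zle].
  have : 0 < (z.1 - u.1) ^+ 2 + (z.2 - u.2) ^+ 2.
    rewrite lt0r paddr_eq0 ?sqr_ge0// !sqrf_eq0 !subr_eq0 addr_ge0 ?sqr_ge0//.
    by rewrite andbT; apply: contraNN zu => /andP[/eqP e1 /eqP e2]; apply/eqP/point_eq.
  by move: zle; rewrite !expr2; lra.
- move=> a b; rewrite !mem_filter => /andP[au aB] /andP[bu bB] ab.
  by apply: genB; rewrite // eq_sym.
- by rewrite mem_filter yu.
rewrite mem_filter => /andP[zu zB] Hz.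
exists u, z; apply/and4P; split=> //; first by rewrite eq_sym.
apply/allP => a aB; have [//|au] := eqVneq a u; have [//|az] := eqVneq a z.
by rewrite Hz// mem_filter au.
Qed.

(** The linear form is [orient v u], positive on all points except [u] and [v]. So [v] is left out
    of the angular minimum around [u], and the old edge shows that it lies left of the new one. *)
Lemma next_hull_edge v u : hull_edge B v u -> exists y, hull_edge B u y.
Proof.
move=> E; have /and4P[vB uB vu _] := E.
have [y [yB yv yu]] := third_point v u.
have [|||z] := @angular_min (v.2 - u.2) (u.1 - v.1) u
    [seq x <- B | (x != u) && (x != v)] y.
- move=> z; rewrite mem_filter => /andP[/andP[zu zv] zB].
  by have := hull_edge_orient E zB zv zu; rewrite /orient; lra.
- move=> a b; rewrite !mem_filter => /andP[/andP[au _] aB] /andP[/andP[bu _] bB] ab.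
  by apply: genB; rewrite // eq_sym.
- by rewrite mem_filter yu yv.
rewrite mem_filter => /andP[/andP[zu zv] zB] Hz.
exists z; apply/and4P; split=> //; first by rewrite eq_sym.
apply/allP => a aB; have [//|au] := eqVneq a u; have [//|az] := eqVneq a z.
have [->|av] := eqVneq a v; last by rewrite Hz// mem_filter au av.
by rewrite -orient_rot (hull_edge_orient E).
Qed.

Let T : finType := seq_sub B.

(** A point that starts no hull edge is fixed, which makes [next] injective on all of [B]. *)
Let next (x : T) : T := odflt x [pick y : T | hull_edge B (val x) (val y)].

Lemma nextP (x : T) : (exists y, hull_edge B (val x) y) ->
  hull_edge B (val x) (val (next x)).
Proof.
move=> [y xy]; have /and4P[_ yB _ _] := xy.
by rewrite /next; case: pickP => //= /(_ (SeqSub yB)); rewrite xy.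
Qed.

Lemma next_stuck (x : T) : (forall y, ~~ hull_edge B (val x) y) -> next x = x.
Proof. by move=> nx; rewrite /next; case: pickP => //= y; rewrite (negPf (nx _)). Qed.

(** If edges from distinct [x] and [y] ended at one point, each start would lie left of the other
    edge, which asks for opposite signs of one orientation. A fixed point starting no edge is not
    the end of an edge either, since every edge has a successor. *)
Lemma next_inj : injective next.
Proof.
move=> x y.
have [hx|/forallNP hx] := pselect (exists z, hull_edge B (val x) z);
have [hy|/forallNP hy] := pselect (exists z, hull_edge B (val y) z).
- have Ex := nextP hx; have Ey := nextP hy => e; rewrite -e in Ey.
  apply/val_inj/eqP; apply: contrapT => /negP xy.
  have /and4P[xB _ nx _] := Ex; have /and4P[yB _ ny _] := Ey.
  have := hull_edge_orient Ex yB; rewrite eq_sym => /(_ xy ny).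
  have := hull_edge_orient Ey xB xy nx.
  by rewrite /orient; lra.
- rewrite (next_stuck (fun z => introN idP (hy z))) => e.
  by have [z] := next_hull_edge (nextP hx); rewrite e => /hy.
- rewrite (next_stuck (fun z => introN idP (hx z))) => e.
  by have [z] := next_hull_edge (nextP hy); rewrite -e => /hx.
- by rewrite (next_stuck (fun z => introN idP (hx z)))
    (next_stuck (fun z => introN idP (hy z))).
Qed.

Lemma hull_cycle : exists (n : nat) (v : nat -> point),
  [/\ (3 <= n)%N, forall i, v (i + n)%N = v i,
      forall i j, (i < n)%N -> (j < n)%N -> v i = v j -> i = j,
      forall i, v i \in B &
      forall i x, x \in B -> x != v i -> x != v i.+1 ->
        0 < orient (v i) (v i.+1) x].
Proof.
have [v0 [v1 E0]] := first_hull_edge.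
have /and4P[v0B _ _ _] := E0.
pose x0 : T := SeqSub v0B.
pose n := fingraph.order next x0; pose v i := val (iter i next x0).
have hull_edge_v i : hull_edge B (v i) (v i.+1).
  elim: i => [|i IH]; first by apply: nextP; exists v1.
  by apply: nextP; exact: next_hull_edge IH.
have per i : v (i + n)%N = v i by rewrite /v iterD iter_order//; exact: next_inj.
(* Excludes cycles of length two, where a third point would lie left of an edge and of its
   reverse. *)
have third i : exists x, 0 < orient (v i) (v i.+1) x /\ 0 < orient (v i.+1) (v i.+2) x
    \/ v i.+2 != v i.
  have [x [xB xv xu]] := third_point (v i) (v i.+1).
  exists x; have [e|] := eqVneq (v i.+2) (v i); last by right.
  left; split; apply: hull_edge_orient => //; by rewrite e.
exists n, v; split => //.
- have : (0 < n)%N by exact: fingraph.order_gt0.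
  case en : n => [//|[|[|//]]] _.
    have /and4P[_ _ + _] := hull_edge_v 0%N.
    by have := per 0%N; rewrite en add0n => ->; rewrite eqxx.
  have := per 0%N; rewrite en add0n => e; have [x []] := third 0%N; rewrite e ?eqxx//.
  by move=> []; rewrite [orient (v 1%N) _ _]orient_swap; lra.
- move=> i j lin ljn /val_inj e.
  by rewrite -(findex_iter lin) e findex_iter.
- by move=> i; have /and4P[] := hull_edge_v i.
- by move=> i x xB xi xi1; apply: hull_edge_orient.
Qed.

End Hull.

(** * Fan triangulation from one vertex *)

Section Fan.
Local Open Scope ring_scope.
Variable R : realType.
Local Notation point := (R * R)%type.

(** As [i] runs from [1] to [n - 1], the sign of [orient (v 0) (v i) u] goes from positive to
    negative. At the change, [u] is inside the triangle [v 0], [v i], [v i.+1]. *)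
Lemma fan_triangle (v : nat -> point) (n : nat) (u : point) :
  (3 <= n)%N -> v n = v 0%N ->
  (forall i, (i < n)%N -> 0 < orient (v i) (v i.+1) u) ->
  (forall i, (0 < i < n)%N -> orient (v 0%N) (v i) u != 0) ->
  exists i (a b c : R), [/\ 0 < a, 0 < b, 0 < c, a + b + c = 1 &
    u = a *: v 0%N + b *: v i + c *: v i.+1].
Proof.
move=> n3 vn pos ne0.
have [i [i1 i2 i3]] : exists i, [/\ (i.+1 < n)%N, 0 < orient (v 0%N) (v i) u &
    orient (v 0%N) (v i.+1) u < 0].
  apply: contrapT => /forallNP H.
  have all_pos i : (i.+1 < n)%N -> 0 < orient (v 0%N) (v i.+1) u.
    elim: i => [|i IH] lin; first by apply: pos; lia.
    have := ne0 i.+2; rewrite lin => /(_ isT); rewrite neq_lt => /orP[lt0|//].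
    by case: (H i.+1); split=> //; apply: IH; lia.
  have p1 : 0 < orient (v n.-1) (v 0%N) u.
    by rewrite -vn -[in v n](_ : n.-1.+1 = n) ?pos//; lia.
  have p2 : 0 < orient (v 0%N) (v n.-1) u.
    by rewrite (_ : n.-1 = n.-2.+1) ?all_pos//; lia.
  by move: p1; rewrite orient_swap; lra.
have pi := pos i (ltnW i1).
have e3 : 0 < orient (v i.+1) (v 0%N) u by rewrite orient_swap; lra.
have sumD := orient_sum (v 0%N) (v i) (v i.+1) u.
have D0 : 0 < orient (v 0%N) (v i) (v i.+1) by lra.
have D1 := lt0r_neq0 D0.
exists i, (orient (v i) (v i.+1) u / orient (v 0%N) (v i) (v i.+1)),
  (orient (v i.+1) (v 0%N) u / orient (v 0%N) (v i) (v i.+1)),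
  (orient (v 0%N) (v i) u / orient (v 0%N) (v i) (v i.+1)).
split; rewrite ?divr_gt0//; last exact: barycentric.
by rewrite -!mulrDl sumD divff.
Qed.
End Fan.

(** * Extreme points of the hull *)

Section ExtremePoints.
Local Open Scope ring_scope.
Variable R : realType.
Local Notation point := (R * R)%type.

Lemma periodic_modn (T : Type) (v : nat -> T) n i :
  (forall i, v (i + n)%N = v i) -> v (i %% n)%N = v i.
Proof.
move=> per; rewrite [in RHS](divn_eq i n).
by elim: (i %/ n)%N => [|k IH]; rewrite ?mul0n// mulSn -addnA addnC per.
Qed.

Lemma periodic_inj_mod (T : Type) (v : nat -> T) n : (2 < n)%N ->
  (forall i, v (i + n)%N = v i) ->
  (forall i j, (i < n)%N -> (j < n)%N -> v i = v j -> i = j) ->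
  forall i j, v i = v j -> i = j %[mod n].
Proof.
move=> n2 per inj i j; rewrite -(periodic_modn i per) -(periodic_modn j per).
by apply: inj; rewrite ltn_mod; lia.
Qed.

(** Removing an extreme point outside [A] from the hull would leave a smaller convex set containing
    [A]. *)
Lemma extreme_points_conv_hull (A : set point) x :
  extreme_points (conv_hull A) x -> A x.
Proof.
move=> [Ax ext]; apply: contrapT => nAx.
suff: conv_hull A `<=` conv_hull A `\ x by move=> /(_ x Ax)[_ /(_ erefl)].
apply: smallest_sub; last first.
  by move=> y Ay; split; [exact: sub_gen_smallest | move=> /= yx; rewrite -yx in nAx].
apply/convex_setW => y z; rewrite !inE => -[Ay yx] [Az zx] k k0 k1.
have e : conv k (y : convex_lmodType point) z =
    (1 - (1 - k%:num)) *: y + (1 - k%:num) *: z by rewrite subKr.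
rewrite inE e; split; first by apply: conv_hull_convex => //; lra.
move=> /= xE; apply: yx.
by have [] := ext y z (1 - k%:num) Ay Az _ (esym xE); first lra.
Qed.

(** A point of [B] off the cycle lies inside a fan triangle, hence strictly between [v 0] and a
    point of the opposite side. Conversely, a segment of the hull through a vertex in its relative
    interior must lie on the lines of both adjacent edges, which meet only in that vertex. *)
Lemma hull_cycle_extreme_points (B : seq point) (n : nat) (v : nat -> point) :
  (forall x y z, x \in B -> y \in B -> z \in B ->
    x != y -> x != z -> y != z -> orient x y z != 0) ->
  (3 <= n)%N -> (forall i, v (i + n)%N = v i) ->
  (forall i j, (i < n)%N -> (j < n)%N -> v i = v j -> i = j) ->
  (forall i, v i \in B) ->
  (forall i x, x \in B -> x != v i -> x != v i.+1 ->
     0 < orient (v i) (v i.+1) x) ->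
  extreme_points (conv_hull [set` B]) = [set` mkseq v n].
Proof.
move=> genB n3 per inj vB pos.
have vmod := periodic_inj_mod n3 per inj.
have ge0 i x : conv_hull [set` B] x -> 0 <= orient (v i) (v i.+1) x.
  apply: conv_hull_orient_ge0 => y /= yB.
  have [->|yi] := eqVneq y (v i); first by rewrite orient_baa.
  have [->|yi1] := eqVneq y (v i.+1); first by rewrite orient_bab.
  exact/ltW/pos.
apply/seteqP; split => x.
  move=> ext; have xB := extreme_points_conv_hull ext.
  apply: contrapT => /negP /mapP xv.
  have xn i : (i < n)%N -> x != v i.
    by move=> lin; apply/eqP => xvi; apply: xv; exists i; rewrite // mem_iota.
  have vn : v n = v 0%N by rewrite -[n]add0n per.
  have xn1 i : (i < n)%N -> x != v i.+1.
    rewrite leq_eqVlt => /predU1P[->|]; last exact: xn.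
    by rewrite vn xn//; lia.
  have [||i [a [b [c [a0 b0 c0 abc xE]]]]] := @fan_triangle _ v n x n3 vn.
  - by move=> i lin; apply: pos; [exact: xB|exact: xn|exact: xn1].
  - move=> i /andP[i0 lin]; apply: genB => //.
    + by apply/eqP => /inj; lia.
    + by rewrite eq_sym xn//; lia.
    + by rewrite eq_sym xn.
  have [_ /(_ (v 0%N) ((b / (1 - a)) *: v i + (c / (1 - a)) *: v i.+1) (1 - a))] := ext.
  have a1' : 0 < 1 - a by lra.
  have a1 := lt0r_neq0 a1'.
  have vh j : conv_hull [set` B] (v j) by apply: sub_gen_smallest; exact: vB.
  case=> //.
  - have -> : b / (1 - a) = 1 - c / (1 - a).
      by have -> : b = 1 - a - c by [lra]; field.
    apply: conv_hull_convex => //; rewrite divr_ge0 ?ler_pdivrMr; lra.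
  - lra.
  - rewrite xE subKr scalerDr !scalerA addrA.
    by rewrite ![(1 - a) * (_ / _)]mulrC !divfK.
  by move=> /eqP; rewrite eq_sym (negPf (xn _ _))//; lia.
move=> /mapP[i _ ->].
(* Adding a period first gives every vertex a predecessor, also when [i = 0]. *)
have -> : v i = v (i + n).-1.+1 by rewrite (_ : (i + n).-1.+1 = i + n)%N ?per//; lia.
move: (i + n).-1 => {}i.
split; first by apply: sub_gen_smallest; exact: vB.
move=> a b t Ha Hb /andP[t0 t1] e.
have v20 : v i.+2 != v i.
  apply/eqP => /vmod /eqP; rewrite -addn2 -{2}[i]addn0 eqn_modDl mod0n.
  by rewrite modn_small//; lia.
have v21 : v i.+2 != v i.+1.
  apply/eqP => /vmod /eqP; rewrite -addn1 -{2}[i.+1]addn0 eqn_modDl mod0n.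
  by rewrite modn_small//; lia.
have D0 := pos i (v i.+2) (vB _) v20 v21.
have zero (f : point -> R) : f (v i.+1) = 0 -> 0 <= f a -> 0 <= f b ->
    f ((1 - t) *: a + t *: b) = (1 - t) * f a + t * f b -> f a = 0 /\ f b = 0.
  rewrite -e => -> fa fb /esym/eqP; have ta : 0 <= (1 - t) * f a by nra.
  have tb : 0 <= t * f b by nra.
  rewrite paddr_eq0// !mulf_eq0 subr_eq0 (gt_eqF t1) (gt_eqF t0)/=.
  by move=> /andP[/eqP-> /eqP->].
have [||||a1 b1] := zero (orient (v i) (v i.+1)); rewrite ?ge0 ?orient_bab//.
  by rewrite orient_comb2 ?subrK.
have [||||a2 b2] := zero (orient (v i.+1) (v i.+2)); rewrite ?ge0 ?orient_baa//.
  by rewrite orient_comb2 ?subrK.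
have uniq_zero z : orient (v i) (v i.+1) z = 0 -> orient (v i.+1) (v i.+2) z = 0 ->
    z = v i.+1.
  move=> z1 z2; rewrite (barycentric z (lt0r_neq0 D0)).
  have := orient_sum (v i) (v i.+1) (v i.+2) z; rewrite z1 z2 add0r addr0 => ->.
  by rewrite mul0r !scale0r add0r addr0 divff ?scale1r// lt0r_neq0.
by split; apply: uniq_zero.
Qed.
End ExtremePoints.

(** * Matching points with hull edges *)

Section Assignment.
Local Open Scope ring_scope.

(** A permutation minimizing the whole product is compared with its composite with the transposition
    of [i] and [j]; the common factors are positive and cancel. *)
Lemma prod_min_perm (R : realType) (n : nat) (A : 'I_n -> 'I_n -> R) :
  (forall i j, 0 < A i j) -> exists s : {perm 'I_n},
    forall i j, A i (s i) * A j (s j) <= A i (s j) * A j (s i).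
Proof.
move=> A0.
have [s _ smin] := @arg_minP _ R {perm 'I_n} (1%g : {perm 'I_n}) predT
  (fun s : {perm 'I_n} => \prod_i A i (s i)) isT.
exists s => i j; have [->//|ij] := eqVneq i j.
have := smin (tperm i j * s)%g isT.
have ji : j != i by rewrite eq_sym.
rewrite (bigD1 i)//= (bigD1 j)//= [leRHS](bigD1 i)//= [X in _ <= _ * X](bigD1 j)//=.
rewrite !permM tpermL tpermR !mulrA.
rewrite [X in _ <= _ * X](eq_bigr (fun k => A k (s k))); last first.
  by move=> k /andP[ki kj]; rewrite permM tpermD// eq_sym.
by rewrite ler_pM2r// prodr_gt0.
Qed.

Lemma prod_min_assignment (R : realType) (T : eqType) (x0 : T) (n : nat)
    (W : seq T) (f : nat -> T -> R) : uniq W -> size W = n ->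
  (forall i x, (i < n)%N -> x \in W -> 0 < f i x) ->
  exists w : nat -> T, [/\ forall i, (i < n)%N -> w i \in W,
    forall i j, (i < n)%N -> (j < n)%N -> w i = w j -> i = j &
    forall i j, (i < n)%N -> (j < n)%N ->
      f i (w i) * f j (w j) <= f i (w j) * f j (w i)].
Proof.
move=> uW sW f0.
have [|s smin] := @prod_min_perm R n (fun i j => f i (nth x0 W j)).
  by move=> i j; apply: f0; rewrite // mem_nth ?sW.
(* For [i >= n] the index stays [i] and [nth] returns [x0]. *)
pose w i := nth x0 W (odflt i (omap (fun o : 'I_n => val (s o)) (insub i))).
have wE i (lin : (i < n)%N) : w i = nth x0 W (s (Ordinal lin)) by rewrite /w insubT.
exists w; split => [i lin|i j lin ljn|i j lin ljn].
- by rewrite wE mem_nth ?sW.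
- rewrite !wE => /eqP; rewrite nth_uniq ?sW// => /eqP/val_inj/perm_inj.
  by move=> /(congr1 val).
- by rewrite !wE; exact: (smin (Ordinal lin) (Ordinal ljn)).
Qed.
End Assignment.

(** * Rays are connected and unbounded *)

Section Rays.
Local Open Scope ring_scope.
Variable R : realType.
Local Notation point := (R * R)%type.

Lemma ray_connected (r d : point) :
  connected [set r + t *: d | t in [set t : R | 0 <= t]].
Proof.
apply: connected_continuous_connected.
  apply/connected_intervalP => x y /= x0 y0 z /andP[xz _].
  exact: le_trans x0 xz.
apply: continuous_subspaceT => t.
apply: cvgD; first exact: cvg_cst.
by apply: cvgZr_tmp; exact: cvg_id.
Qed.

Lemma ray_unbounded (r d : point) : d != 0 ->
  ~ bounded_set [set r + t *: d | t in [set t : R | 0 <= t]].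
Proof.
move=> d0 /= bnd.
have [M [_ HM]] := bnd.
have := HM (`|M| + 1) _.
have dn : 0 < `|d| by rewrite normr_gt0.
(* The added multiple of [d] has the norm of [r] plus that of [M] plus [2], so the point violates
   the bound. *)
move=> /(_ _ (r + ((`|r| + `|M| + 2) / `|d|) *: d)) H.
have : `|r + ((`|r| + `|M| + 2) / `|d|) *: d| <= `|M| + 1.
  apply: H; first by rewrite (le_lt_trans (ler_norm M))// ltrDl.
  by exists ((`|r| + `|M| + 2) / `|d|) => //=; rewrite divr_ge0// !addr_ge0.
apply/negP; rewrite -ltNge.
rewrite [r + _]addrC; apply: lt_le_trans (lerB_normD _ _).
rewrite normrZ normf_div normr_id divfK ?gt_eqF//.
have N0 : 0 <= `|r| + `|M| + 2 by rewrite !addr_ge0.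
rewrite (ger0_norm N0) -[X in _ < X - _]addrA [X in _ < X - _]addrC addrK.
by rewrite ltrD2l ltr1n.
Qed.
End Rays.

(** * The polygon *)

Section SpikedPolygon.
Local Open Scope ring_scope.
Variable R : realType.
Local Notation point := (R * R)%type.

(* If [x] lies in the triangles [w a b] and [w' a' b'], then evaluating the two
   affine functions vanishing on [a b] and on [a' b'] at [x] gives
   [(s' C + q) (s E + p) = s s' A D <= s s' C E]. *)
Lemma separated_triangles (s s' p q A C D E : R) :
  0 <= s -> 0 <= s' -> 0 <= p -> 0 <= q -> 0 < A -> 0 < C -> 0 < D -> 0 < E ->
  A * D <= C * E -> s * A = s' * C + q -> s' * D = s * E + p ->
  p = 0 /\ q = 0.
Proof.
move=> s0 s'0 p0 q0 A0 C0 D0 E0 AD e1 e2.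
have h : s' * C * p + q * (s * E) + q * p = s * s' * (A * D - C * E).
  have -> : s * s' * (A * D - C * E) = (s * A) * (s' * D) - s * s' * C * E by ring.
  by rewrite e1 e2; ring.
have h1 : 0 <= s' * C * p by rewrite !mulr_ge0// ltW.
have h2 : 0 <= q * (s * E) by rewrite !mulr_ge0// ltW.
have h3 : 0 <= q * p by rewrite !mulr_ge0.
have h4 : 0 <= s * s' by rewrite mulr_ge0.
have h5 : s * s' * (A * D - C * E) <= 0 by rewrite mulr_ge0_le0// subr_le0.
have z1 : s' * C * p = 0 by lra.
have z2 : q * (s * E) = 0 by lra.
(* If [s = 0], the first equation kills [q] and [s'], and the second then kills [p]. Otherwise
   [q = 0], so the first equation makes [s'] nonzero and [p = 0] follows. *)
have [sz|sz] := eqVneq s 0.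
  have : 0 <= s' * C by rewrite mulr_ge0// ltW.
  move: e1 e2; rewrite sz !mul0r add0r => e1 e2 s'C.
  have q_0 : q = 0 by lra.
  have : s' * C = 0 by lra.
  move=> /eqP; rewrite mulf_eq0 (gt_eqF C0) orbF => /eqP s'z.
  by split=> //; rewrite -e2 s'z mul0r.
have qz : q = 0.
  by move/eqP: z2; rewrite !mulf_eq0 (negPf sz) (gt_eqF E0) !orbF => /eqP.
split=> //; move: e1; rewrite qz addr0 => e1.
have s'z : s' != 0.
  by apply: contra_eqN e1 => /eqP->; rewrite mul0r mulf_neq0// gt_eqF.
by move/eqP: z1; rewrite !mulf_eq0 (negPf s'z) (gt_eqF C0) => /eqP.
Qed.

Variables (n : nat) (v w : nat -> point).
Hypothesis n3 : (3 <= n)%N.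
Hypothesis v_per : forall i, v (i + n)%N = v i.
Hypothesis v_inj : forall i j, (i < n)%N -> (j < n)%N -> v i = v j -> i = j.
Hypothesis v_pos : forall i j, v j != v i -> v j != v i.+1 ->
  0 < orient (v i) (v i.+1) (v j).
Hypothesis w_pos : forall i j, (j < n)%N -> 0 < orient (v i) (v i.+1) (w j).
Hypothesis w_gen : forall i j k, (i < n)%N -> (j < n)%N -> i != j ->
  orient (v k) (w i) (w j) != 0.
Hypothesis w_min : forall i j, (i < n)%N -> (j < n)%N ->
  orient (v i) (v i.+1) (w i) * orient (v j) (v j.+1) (w j) <=
  orient (v i) (v i.+1) (w j) * orient (v j) (v j.+1) (w i).

Let v_mod := periodic_inj_mod n3 v_per v_inj.

(** The weights are arguments because edges and intersections of triangles are described by which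
    weights vanish. *)
Definition in_triangle i (a b c : R) (x : point) :=
  [/\ 0 <= a, 0 <= b, 0 <= c, a + b + c = 1 &
      x = a *: w i + b *: v i + c *: v i.+1].

Lemma v_orient_ge0 i j : 0 <= orient (v i) (v i.+1) (v j).
Proof.
have [->|ji] := eqVneq (v j) (v i); first by rewrite orient_baa.
have [->|ji1] := eqVneq (v j) (v i.+1); first by rewrite orient_bab.
exact/ltW/v_pos.
Qed.

Lemma v_orient_eq0 i j : orient (v i) (v i.+1) (v j) = 0 ->
  v j = v i \/ v j = v i.+1.
Proof.
move=> e; have [|ji] := eqVneq (v j) (v i); first by left.
have [|ji1] := eqVneq (v j) (v i.+1); first by right.
by have := v_pos ji ji1; rewrite e ltxx.
Qed.

Lemma vS_inj i j : (i < n)%N -> (j < n)%N -> v i.+1 = v j.+1 -> i = j.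
Proof.
move=> lin ljn /v_mod/eqP; rewrite -(addn1 i) -(addn1 j) eqn_modDr !modn_small//.
by move=> /eqP.
Qed.

(** Otherwise [i] and [i + 2] would agree modulo [n >= 3]. *)
Lemma not_both_next i j : v j = v i.+1 -> v i <> v j.+1.
Proof.
move=> /v_mod e1 /v_mod/eqP; rewrite -(addn1 j) -modnDml e1 modnDml addn1 -addn2.
by rewrite -{1}[i]addn0 eqn_modDl mod0n modn_small//; lia.
Qed.

Lemma triangle_coef i j a b c x : in_triangle i a b c x ->
  orient (v j) (v j.+1) x = a * orient (v j) (v j.+1) (w i) +
    (b * orient (v j) (v j.+1) (v i) + c * orient (v j) (v j.+1) (v i.+1)).
Proof. by case=> _ _ _ abc ->; rewrite orient_comb// addrA. Qed.

Lemma triangle_unique i a b c a' b' c' x : (i < n)%N ->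
  in_triangle i a b c x -> in_triangle i a' b' c' x ->
  [/\ a = a', b = b' & c = c'].
Proof.
move=> lin H H'; have D0 := lt0r_neq0 (w_pos i lin).
have aa : a = a'.
  apply: (mulIf D0).
  have := triangle_coef i H; rewrite (triangle_coef i H').
  by rewrite orient_baa orient_bab !mulr0 !addr0.
have [_ _ _ abc xE] := H; have [_ _ _ abc' xE'] := H'.
have cc : c = c'.
  have D1 : orient (w i) (v i) (v i.+1) != 0 by rewrite orient_rot.
  apply: (mulIf D1).
  have := congr1 (orient (w i) (v i)) xE; rewrite {1}xE' !orient_comb//.
  by rewrite orient_baa orient_bab !mulr0 !add0r.
by split=> //; lra.
Qed.

(** Evaluating at [x] the affine functions vanishing on hull edges [i] and [j] gives the two
    equations of [separated_triangles], with [p] and [q] the contributions of the hull vertices.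
    Since these vanish, a hull vertex with nonzero weight lies on the other hull edge, so it is
    shared. *)
Lemma triangles_meet_coef i j a b c a' b' c' x : (i < n)%N -> (j < n)%N ->
  in_triangle i a b c x -> in_triangle j a' b' c' x -> i != j ->
  [/\ b != 0 -> v i = v j.+1, c != 0 -> v j = v i.+1,
      b' != 0 -> v j = v i.+1 & c' != 0 -> v i = v j.+1].
Proof.
move=> lin ljn H H' ij.
have [a0 b0 c0 _ _] := H; have [a'0 b'0 c'0 _ _] := H'.
have e1 := triangle_coef i H'; rewrite (triangle_coef i H) in e1.
have e2 := triangle_coef j H; rewrite (triangle_coef j H') in e2.
rewrite orient_baa orient_bab !mulr0 !addr0 in e1.
rewrite orient_baa orient_bab !mulr0 !addr0 in e2.
have P0 k l (s t : R) : 0 <= s -> 0 <= t ->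
    0 <= s * orient (v k) (v k.+1) (v l) + t * orient (v k) (v k.+1) (v l.+1).
  by move=> s0 t0; rewrite addr_ge0// mulr_ge0// v_orient_ge0.
have [] := separated_triangles a0 a'0 (P0 j i b c b0 c0) (P0 i j b' c' b'0 c'0)
  (w_pos i lin) (w_pos i ljn) (w_pos j ljn) (w_pos j lin) (w_min lin ljn) e1 e2.
move=> /eqP; rewrite paddr_eq0 ?mulr_ge0 ?v_orient_ge0// !mulf_eq0 => /andP[p1 p2].
move=> /eqP; rewrite paddr_eq0 ?mulr_ge0 ?v_orient_ge0// !mulf_eq0 => /andP[q1 q2].
have vij : v i <> v j by move=> /v_inj e; move/eqP: ij; apply; exact: e.
have vSij : v i.+1 <> v j.+1 by move=> /vS_inj e; move/eqP: ij; apply; exact: e.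
split=> nz.
- by move: p1; rewrite (negPf nz) => /eqP/v_orient_eq0[].
- by move: p2; rewrite (negPf nz) => /eqP/v_orient_eq0[].
- by move: q1; rewrite (negPf nz) => /eqP/v_orient_eq0[/esym|].
- by move: q2; rewrite (negPf nz) => /eqP/v_orient_eq0[/esym|/esym].
Qed.

(** Only the weights at the tips and at the shared vertex can be nonzero, so [x] is on both sides
    joining that vertex to a tip. The vertex and the two tips are not collinear, so these sides meet
    only in the vertex. *)
Lemma triangles_meet_next i j a b c a' b' c' x : (i < n)%N -> (j < n)%N ->
  in_triangle i a b c x -> in_triangle j a' b' c' x -> i != j ->
  v j = v i.+1 -> c = 1 /\ b' = 1.
Proof.
move=> lin ljn H H' ij vji.
have nvij := not_both_next vji.
have [bz _ _ c'z] := triangles_meet_coef lin ljn H H' ij.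
have b0 : b = 0 by apply/eqP; apply: contrapT => /negP/bz.
have c'0 : c' = 0 by apply/eqP; apply: contrapT => /negP/c'z.
have e1 := triangle_coef i H'; rewrite (triangle_coef i H) in e1.
rewrite b0 c'0 vji orient_baa orient_bab !mul0r !mulr0 !addr0 in e1.
have [_ _ _ abc xE] := H; have [_ _ _ abc' xE'] := H'.
have h : a' * orient (v j) (w i) (w j) = 0.
  have := congr1 (orient (v j) (w i)) xE; rewrite {1}xE' !orient_comb//.
  by rewrite b0 c'0 -vji orient_baa orient_bab !mul0r !mulr0 !addr0.
have a'0 : a' = 0.
  by move/eqP: h; rewrite mulf_eq0 (negPf (w_gen _ _ _ _))// orbF => /eqP.
have a0 : a = 0.
  move/eqP: e1; rewrite a'0 mul0r mulf_eq0 (gt_eqF (w_pos i lin)) orbF.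
  by move=> /eqP.
by split; lra.
Qed.

(** The common point is a shared hull vertex: for nonadjacent hull edges all weights at hull
    vertices vanish, and the tips would coincide. *)
Lemma triangles_meet i j a b c a' b' c' x : (i < n)%N -> (j < n)%N ->
  in_triangle i a b c x -> in_triangle j a' b' c' x -> i != j ->
  c = 1 /\ b' = 1 \/ b = 1 /\ c' = 1.
Proof.
move=> lin ljn H H' ij; have ji : j != i by rewrite eq_sym.
have [bz cz b'z c'z] := triangles_meet_coef lin ljn H H' ij.
have [vji|/eqP vji] := eqVneq (v j) (v i.+1).
  by left; exact: triangles_meet_next H H' ij vji.
have [vij|/eqP vij] := eqVneq (v i) (v j.+1).
  by right; have [] := triangles_meet_next ljn lin H' H ji vij.
have b0 : b = 0 by apply/eqP; apply: contrapT => /negP/bz.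
have c0 : c = 0 by apply/eqP; apply: contrapT => /negP/cz.
have b'0 : b' = 0 by apply/eqP; apply: contrapT => /negP/b'z.
have c'0 : c' = 0 by apply/eqP; apply: contrapT => /negP/c'z.
have [_ _ _ abc xE] := H; have [_ _ _ abc' xE'] := H'.
have a1 : a = 1 by lra.
have a'1 : a' = 1 by lra.
move: xE; rewrite xE' a1 a'1 b0 c0 b'0 c'0 !scale0r !addr0 !scale1r => e.
by have := w_gen i lin ljn ij; rewrite e orient_bab eqxx.
Qed.

Definition spike_vertex t : point := if odd t then w t./2 else v t./2.

Definition spiked_polygon := mkseq spike_vertex (2 * n).

Lemma size_spiked_polygon : size spiked_polygon = (2 * n)%N.
Proof. exact: size_mkseq. Qed.

Lemma edge_start_spiked t : (t < 2 * n)%N ->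
  edge_start spiked_polygon t = spike_vertex t.
Proof. by move=> lt; rewrite /edge_start nth_mkseq. Qed.

(** The last edge closes up because [spike_vertex (2 * n)] is [v n = v 0]. *)
Lemma edge_end_spiked t : (t < 2 * n)%N ->
  edge_end spiked_polygon t = spike_vertex t.+1.
Proof.
rewrite /edge_end size_spiked_polygon leq_eqVlt => /predU1P[->|lt].
  rewrite modnn nth_mkseq; last by lia.
  by rewrite /spike_vertex oddM /= mul2n doubleK -[n in RHS]add0n v_per.
by rewrite modn_small// nth_mkseq.
Qed.

(** Edges [2 i] and [2 i + 1] are the two sides of triangle [i] at its tip [w i]; on each, the
    weight of the opposite vertex is zero. *)
Lemma edge_in_triangle t x : (t < 2 * n)%N -> edge spiked_polygon t x ->
  exists a b c, in_triangle t./2 a b c x /\ (if odd t then b = 0 else c = 0).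
Proof.
move=> lt [s]; rewrite /= in_itv /= => /andP[s0 s1].
rewrite edge_start_spiked// edge_end_spiked// /spike_vertex /= uphalf_half.
case: (odd t) => /= xE.
  exists (1 - s), 0, s; split=> //; split; rewrite ?subr_ge0//; first by ring.
  by rewrite scale0r addr0 -xE.
exists s, (1 - s), 0; split=> //; split; rewrite ?subr_ge0//; first by ring.
by rewrite scale0r addr0 -xE addrC.
Qed.

Lemma v_neq_w i j : (j < n)%N -> v i != w j.
Proof.
move=> ljn; apply/eqP => e; have := w_pos i ljn.
by rewrite -e orient_baa ltxx.
Qed.

Lemma uniq_spiked_polygon : uniq spiked_polygon.
Proof.
apply/mkseq_uniqP => t t'; rewrite !inE /spike_vertex => lt lt'.
have h : (t./2 < n)%N by lia.
have h' : (t'./2 < n)%N by lia.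
have et := odd_double_half t; have et' := odd_double_half t'.
case: (odd t) et => et; case: (odd t') et' => et' e.
- suff: t./2 = t'./2 by lia.
  apply/eqP; apply: contrapT => /negP ne.
  by have := w_gen 0 h h' ne; rewrite e orient_bab eqxx.
- by have := v_neq_w t'./2 h; rewrite e eqxx.
- by have := v_neq_w t./2 h'; rewrite e eqxx.
- by have := v_inj h h' e; lia.
Qed.

Lemma simple_spiked_polygon : simple_polygon spiked_polygon.
Proof.
split; [by rewrite size_spiked_polygon; lia|exact: uniq_spiked_polygon|].
rewrite size_spiked_polygon => t t' lt lt' tt' x [].
have h : (t./2 < n)%N by lia.
have h' : (t'./2 < n)%N by lia.
have et := odd_double_half t; have et' := odd_double_half t'.
move=> /(edge_in_triangle lt)[a [b [c [T od]]]].
move=> /(edge_in_triangle lt')[a' [b' [c' [T' od']]]].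
have [a0 b0 c0 abc xE] := T; have [a'0 b'0 c'0 abc' xE'] := T'.
rewrite !edge_start_spiked// !edge_end_spiked// /spike_vertex /= !uphalf_half.
(* Distinct edges of one triangle have indices of different parity, so both weights at hull vertices
   vanish and the common point is the tip. *)
have [e|ne] := eqVneq t./2 t'./2.
  rewrite e in T xE et h *; have [ea eb ec] := triangle_unique h' T T'.
  suff [bz cz] : b = 0 /\ c = 0.
    have a1 : a = 1 by lra.
    have -> : x = w t'./2 by rewrite xE bz cz a1 !scale0r !addr0 scale1r.
    by case: (odd t); case: (odd t'); split => /=; by [left|right].
  case: (odd t) od et => od et; case: (odd t') od' et' => od' et';
    (try by move/eqP: tt'; lia); by split; rewrite ?od// ?eb ?ec ?od'.
(* The weight equal to [1] decides the parity of each index, hence which end of the edge the shared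
   vertex is. *)
have [[c1 b'1]|[b1 c'1]] := triangles_meet h h' T T' ne.
  have az : a = 0 by lra. have bz : b = 0 by lra.
  have a'z : a' = 0 by lra. have c'z : c' = 0 by lra.
  have x1 : x = v t./2.+1 by rewrite xE az bz c1 !scale0r !add0r scale1r.
  have x2 : x = v t'./2 by rewrite xE' a'z c'z b'1 !scale0r add0r addr0 scale1r.
  case: (odd t) od => od; last by move: c1; rewrite od => /esym/eqP; rewrite oner_eq0.
  case: (odd t') od' => od'.
    by move: b'1; rewrite od' => /esym/eqP; rewrite oner_eq0.
  by split; [right; rewrite x1|left; rewrite x2].
have az : a = 0 by lra. have cz : c = 0 by lra.
have a'z : a' = 0 by lra. have b'z : b' = 0 by lra.
have x1 : x = v t./2 by rewrite xE az cz b1 !scale0r add0r addr0 scale1r.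
have x2 : x = v t'./2.+1 by rewrite xE' a'z b'z c'1 !scale0r !add0r scale1r.
case: (odd t) od => od; first by move: b1; rewrite od => /esym/eqP; rewrite oner_eq0.
case: (odd t') od' => od'; last by move: c'1; rewrite od' => /esym/eqP; rewrite oner_eq0.
by split; [left; rewrite x1|right; rewrite x2].
Qed.

(* The ray issuing from [r] away from [w i] leaves the triangle through the hull
   edge [v i v i.+1] and then stays outside the hull. *)
Lemma escaping_ray i a b c r (t : R) : (i < n)%N -> in_triangle i a b c r ->
  0 < b -> 0 < c -> 0 <= t ->
  ~ polygon_curve spiked_polygon (r + t *: (r - w i)).
Proof.
move=> lin T b0 c0 t0 [u]; rewrite /= size_spiked_polygon => ltu.
move=> /(edge_in_triangle ltu)[a' [b' [c' [T' od]]]].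
have hu : (u./2 < n)%N by lia.
have [a0 _ _ abc rE] := T.
set y := r + _ in T'.
have abc'' : ((1 + t) * a - t) + (1 + t) * b + (1 + t) * c = 1.
  have -> : c = 1 - a - b by lra.
  by ring.
have yE : y = ((1 + t) * a - t) *: w i + ((1 + t) * b) *: v i + ((1 + t) * c) *: v i.+1.
  by rewrite /y rE; apply: point_eq; rewrite !coordE; ring.
(* On the curve, [y] would not be to the right of the line of hull edge [i], so it would still lie
   in triangle [i]. Its weights at [v i] and [v i.+1] are both positive, which no point of an edge
   allows. *)
have a''0 : 0 <= (1 + t) * a - t.
  have D0 := w_pos i lin.
  rewrite -(pmulr_lge0 _ D0).
  have -> : ((1 + t) * a - t) * orient (v i) (v i.+1) (w i) = orient (v i) (v i.+1) y.
    by rewrite yE orient_comb// orient_baa orient_bab !mulr0 !addr0.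
  rewrite (triangle_coef i T'); have [? ? ? _ _] := T'.
  by rewrite !addr_ge0// mulr_ge0// ?v_orient_ge0// ltW// w_pos.
have b''0 : 0 < (1 + t) * b by rewrite mulr_gt0//; lra.
have c''0 : 0 < (1 + t) * c by rewrite mulr_gt0//; lra.
have T'' : in_triangle i ((1 + t) * a - t) ((1 + t) * b) ((1 + t) * c) y.
  by split=> //; exact: ltW.
have [e|ne] := eqVneq i u./2.
  rewrite -e in T'; have [_ eb ec] := triangle_unique lin T'' T'.
  by case: (odd u) od => od; lra.
by have [[]|[]] := triangles_meet lin hu T'' T' ne; lra.
Qed.

(** The escaping ray is connected, starts at [r] and avoids the curve, so the component of [r]
    contains this unbounded set. *)
Lemma triangle_exterior i a b c r : (i < n)%N -> in_triangle i a b c r ->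
  0 < b -> 0 < c -> exterior spiked_polygon r.
Proof.
move=> lin T b0 c0 /= bnd.
have dz : r - w i != 0.
  rewrite subr_eq0; apply/eqP => e.
  have Tw : in_triangle i 1 0 0 r.
    by split=> //; rewrite ?addr0// e !scale0r !addr0 scale1r.
  by have [_ e1 _] := triangle_unique lin T Tw; rewrite e1 ltxx in b0.
apply: (ray_unbounded (r := r) dz).
move: bnd; apply: sub_boundedr => A /= HA x Rx; apply: HA; move: x Rx.
apply: connected_component_max; last exact: ray_connected.
  by exists 0 => //; rewrite scale0r addr0.
by move=> _ [t /= t0 <-]; exact: escaping_ray T b0 c0 t0.
Qed.

End SpikedPolygon.

(** * Red points *)

Lemma card_eq_seq (T : pointedType) (A : set T) m : A #= `I_m ->
  exists s : seq T, [/\ uniq s, size s = m & A = [set` s]].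
Proof.
rewrite card_eq_sym => /card_set_bijP[f [fA finj fsurj]].
exists (mkseq f m); rewrite size_mkseq; split=> //.
  by apply/mkseq_uniqP => i j; rewrite !inE => im jm; apply: finj; rewrite inE.
apply/seteqP; split => [x /fsurj[i /= im <-]|x /mapP[i]].
  by apply: map_f; rewrite mem_iota.
by rewrite mem_iota => im ->; apply: fA.
Qed.

Lemma card_eq_seq_size (T : pointedType) (s : seq T) m :
  uniq s -> [set` s] #= `I_m -> size s = m.
Proof.
move=> us /card_eq_seq[t [ut <- st]].
apply/perm_size/uniq_perm => // x.
have : [set` s] x = [set` t] x by rewrite st.
by move=> /= e; apply/idP/idP; rewrite e.
Qed.

Lemma cyclic_sign_change (e : nat -> bool) n i1 i2 : 0 < n ->
  (forall i, e (i + n) = e i) -> e i1 -> ~~ e i2 ->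
  exists i, [/\ i < n, e i & ~~ e i.+1].
Proof.
move=> n0 per e1 e2; apply: contrapT => /forallNP H.
have step i : e i -> e i.+1.
  rewrite -(periodic_modn i per) -(periodic_modn i.+1 per) -[i.+1]addn1 -modnDml.
  rewrite (periodic_modn (i %% n + 1) per) addn1 => ei.
  by apply: contrapT => /negP nei; case: (H (i %% n)); split=> //; rewrite ltn_mod.
have up d : e (i1 + d) by elim: d => [|d IH]; rewrite ?addn0// addnS step.
move: e2; rewrite -(periodic_modn i2 per) -(modnMDl i1 i2 n) (periodic_modn _ per).
(* Since [n > 0], the shift by [i1 * n] moves [i2] to an index at least [i1], and the subtraction is
   not truncated. *)
have -> : i1 * n + i2 = i1 + (i1 * n + i2 - i1) by nia.
by rewrite up.
Qed.

Section RedPoints.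
Local Open Scope ring_scope.
Variable R : realType.
Local Notation point := (R * R)%type.

(** By the cell hypothesis the signs can be read with [w 0] alone. A fan triangle writes [r] as a
    positive combination of three hull vertices, so both signs occur. Where the sign changes from
    positive to negative, it gives the two remaining positive barycentric coordinates of [r]. *)
Lemma red_in_triangle (n : nat) (v w : nat -> point) (r : point) :
  (3 <= n)%N -> (forall i, v (i + n)%N = v i) ->
  (forall i, 0 < orient (v i) (v i.+1) r) ->
  (forall i, (0 < i < n)%N -> orient (v 0%N) (v i) r != 0) ->
  (forall i j, (j < n)%N -> 0 < orient (v i) (v i.+1) (w j)) ->
  (forall i j, (j < n)%N -> orient (v i) r (w j) != 0) ->
  (forall i j k, (j < n)%N -> (k < n)%N ->
     (0 < orient (v i) r (w j)) = (0 < orient (v i) r (w k))) ->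
  exists i a b c, [/\ (i < n)%N, in_triangle v w i a b c r, 0 < b & 0 < c].
Proof.
move=> n3 per rpos rgen wpos rw cell.
have n0 : (0 < n)%N by lia.
have vn : v n = v 0%N by rewrite -[n]add0n per.
pose e i := 0 < orient (v i) r (w 0%N).
have nege i : ~~ e i -> orient (v i) r (w 0%N) < 0.
  by rewrite -leNgt le_eqVlt (negPf (rw _ _ n0)).
have [i0 [a [b [c [a0 b0 c0 abc rE]]]]] := fan_triangle n3 vn (fun i _ => rpos i) rgen.
have comb : a * orient (v 0%N) r (w 0%N) + b * orient (v i0) r (w 0%N) +
    c * orient (v i0.+1) r (w 0%N) = 0.
  rewrite ![orient (v _) _ _]orient_rot -orient_comb// -rE.
  exact: orient_baa.
have [i1 e1] : exists i, e i.
  apply: contrapT => /forallNP H.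
  have h i : orient (v i) r (w 0%N) < 0 by apply: nege; apply/negP/H.
  by have := h 0%N; have := h i0; have := h i0.+1; nra.
have [i2 e2] : exists i, ~~ e i.
  apply: contrapT => /forallNP H.
  have h i : 0 < orient (v i) r (w 0%N) by apply: contrapT => /negP/H.
  by have := h 0%N; have := h i0; have := h i0.+1; nra.
have eper i : e (i + n)%N = e i by rewrite /e per.
have [i [lin ei eSi]] := cyclic_sign_change n0 eper e1 e2.
have D0 : 0 < orient (w i) (v i) (v i.+1) by rewrite orient_rot wpos.
have h1 : 0 < orient (w i) (v i) r by rewrite orient_rot (cell i i 0%N).
have h2 : 0 < orient (v i.+1) (w i) r.
  rewrite orient_swapr oppr_gt0 ltNge le_eqVlt eq_sym (negPf (rw _ _ lin)) /=.
  by rewrite (cell i.+1 i 0%N).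
exists i, (orient (v i) (v i.+1) r / orient (w i) (v i) (v i.+1)),
  (orient (v i.+1) (w i) r / orient (w i) (v i) (v i.+1)),
  (orient (w i) (v i) r / orient (w i) (v i) (v i.+1)).
split=> //; [split|exact: divr_gt0|exact: divr_gt0].
- by rewrite divr_ge0 ?ltW.
- by rewrite divr_ge0 ?ltW.
- by rewrite divr_ge0 ?ltW.
- by rewrite -!mulrDl orient_sum divff ?gt_eqF.
- by apply: barycentric; rewrite gt_eqF.
Qed.
End RedPoints.

(** * The bound and the assembly of the polygon *)

Theorem theorem6 (R : realType) :
  exists K' : nat -> nat -> nat,
    (exists C : nat, forall l n : nat, 0 < l -> 0 < n ->
       K' l n <= C * (n ^ 3 * l ^ 2)) /\
    forall (Blue Red : set (R * R)%type) (l n k : nat),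
      Blue `&` Red = set0 ->
      general_position (Blue `|` Red) ->
      1 <= l -> Red #= `I_l ->
      Red `<=` interior (conv_hull Blue) ->
      extreme_points (conv_hull Blue) #= `I_n ->
      (Blue `&` interior (conv_hull Blue)) #= `I_k ->
      Blue #= `I_(n + k) ->
      K' l n <= k ->
      exists p : seq (R * R)%type,
        [/\ simple_polygon p,
            [set` p] `<=` Blue,
            size p <= 2 * n,
            extreme_points (conv_hull Blue) `<=` [set` p] &
            Red `<=` exterior p].
Proof.
(* The product puts [n] points into one of at most [(n * l)^2 + 1] cells; the summand [3] makes [B]
   large enough for [hull_cycle]. *)
exists (fun l n => n * ((n * l) ^ 2 + 1) + 3); split.
  (* With [q = (n * l)^2 >= 1] and [n >= 1], [n q + n + 3 <= n q + n q + 3 n q]. *)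
  exists 5 => l n l0 n0.
  have -> : n ^ 3 * l ^ 2 = n * (n * l) ^ 2 by rewrite expnMn mulnA -expnS.
  have : 0 < (n * l) ^ 2 by rewrite expn_gt0 muln_gt0 n0 l0.
  by move: ((n * l) ^ 2) => q; nia.
move=> Blue Red l n k disj gp _ /card_eq_seq[rs [urs srs RedE]] Redint ext_n _.
move=> /card_eq_seq[B [uB sB BlueE]] Kk; subst Blue Red.
have neq x y : x \in B -> y \in rs -> x != y.
  move=> xB yrs; apply/eqP => xy.
  have : ([set` B] `&` [set` rs]) x by split=> //=; rewrite xy.
  by rewrite disj.
have genB x y z : x \in B -> y \in B -> z \in B ->
    x != y -> x != z -> y != z -> (orient x y z != 0)%R.
  by move=> xB yB zB; apply: (general_position_orient gp); left.
have genr x y z : x \in B -> y \in B -> z \in rs -> x != y -> (orient x y z != 0)%R.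
  move=> xB yB zrs xy.
  by apply: (general_position_orient gp);
    [left | left | right | | exact: neq | exact: neq].
have sB3 : 3 <= size B by rewrite sB; lia.
have [m [v [m3 per inj vB pos]]] := hull_cycle uB sB3 genB.
have extE := hull_cycle_extreme_points genB m3 per inj vB pos.
have uV : uniq (mkseq v m).
  by apply/mkseq_uniqP => i j; rewrite !inE; exact: inj.
have nm : m = n.
  by rewrite -[m](size_mkseq v); apply: card_eq_seq_size => //; rewrite -extE.
subst m; rewrite extE.
have vV i : v i \in mkseq v n.
  rewrite -(periodic_modn i per); apply: map_f.
  by rewrite mem_iota /= ltn_mod; lia.
(* The candidates for tips are the blue points off the hull cycle, [k] in number because [B] has
   size [n + k]. *)
pose P := [seq x <- B | x \notin mkseq v n].
have sP : size P = k.
  have : size [seq x <- B | x \in mkseq v n] = n.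
    rewrite -[RHS](size_mkseq v); apply/perm_size/uniq_perm => //.
      by rewrite filter_uniq.
    move=> x; rewrite mem_filter andbC; case: (boolP (x \in B)) => //= xB.
    by apply/esym/negP => /mapP[i _ xi]; rewrite xi vB in xB.
  have := count_predC (fun x => x \in mkseq v n) B.
  by rewrite -size_filter sB => + sVB; rewrite sVB => /addnI <-; rewrite size_filter.
pose lines := [seq (v i, r) | i <- iota 0 n, r <- rs].
have slines : size lines = n * l by rewrite size_allpairs size_iota srs.
have off : off_lines lines P.
  move=> L x /allpairsP[[i r] [/= _ rrs ->]]; rewrite mem_filter => /andP[xV xB].
  rewrite /side /= orient_swapr oppr_eq0; apply: genr => //.
  by apply: contraNneq xV => <-.
have [|W [WP sW Wcell]] := @many_in_one_cell _ lines P n off.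
  by rewrite slines sP; lia.
have uW : uniq W by apply: subseq_uniq WP _; rewrite filter_uniq.
have WB x : x \in W -> x \in B /\ forall i, x != v i.
  move=> /(mem_subseq WP); rewrite mem_filter => /andP[xV xB]; split=> // i.
  by apply: contraNneq xV => ->.
have Wpos i x : x \in W -> (0 < orient (v i) (v i.+1) x)%R.
  by move=> /WB[xB xv]; apply: pos.
have [w [wW winj wmin]] := prod_min_assignment (0 : R * R)%R uW sW
  (fun i x (_ : i < n) => @Wpos i x).
have vpos i j : v j != v i -> v j != v i.+1 -> (0 < orient (v i) (v i.+1) (v j))%R.
  exact: pos.
have wpos i j : j < n -> (0 < orient (v i) (v i.+1) (w j))%R by move=> /wW; exact: Wpos.
have wgen i j h : i < n -> j < n -> i != j -> (orient (v h) (w i) (w j) != 0)%R.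
  move=> lin ljn ij; have [wiB wiv] := WB _ (wW _ lin).
  have [wjB wjv] := WB _ (wW _ ljn).
  apply: genB; rewrite // 1?eq_sym//.
  by apply: contraNneq ij => /winj ->.
exists (spiked_polygon n v w); split.
- exact: simple_spiked_polygon.
- move=> x /= /mapP[t]; rewrite mem_iota /= => lt ->; rewrite /spike_vertex.
  by case: (odd t); rewrite ?vB//; apply: (WB _ (wW _ _)).1; lia.
- by rewrite size_spiked_polygon.
- move=> x /= /mapP[i]; rewrite mem_iota /= => lin ->; apply/mapP; exists i.*2.
    by rewrite mem_iota /=; lia.
  by rewrite /spike_vertex odd_double doubleK.
move=> r /= rrs.
have rhull : conv_hull [set` B] r by apply: interior_subset; exact: Redint.
have vS i : v i != v i.+1.
  apply/eqP => /(periodic_inj_mod m3 per inj)/eqP.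
  by rewrite -[i.+1]addn1 -{1}[i]addn0 eqn_modDl mod0n modn_small//; lia.
have [|||||i [a [b [c [lin T b0 c0]]]]] := @red_in_triangle R n v w r m3 per.
(* Membership in the hull gives the weak inequality, and general position excludes zero. *)
- move=> i; rewrite lt0r genr//=; apply: conv_hull_orient_ge0 rhull => x /= xB.
  have [->|xi] := eqVneq x (v i); first by rewrite orient_baa.
  have [->|xi1] := eqVneq x (v i.+1); first by rewrite orient_bab.
  exact/ltW/pos.
- move=> i /andP[i0 lin]; apply: genr => //; apply/eqP => /inj; lia.
- exact: wpos.
- move=> i j ljn; have [wjB wjv] := WB _ (wW _ ljn).
  by rewrite orient_swapr oppr_eq0; apply: genr; rewrite // eq_sym.
(* The list [lines] only has indices below [n], hence the reduction of [i]. *)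
- move=> i j h ljn lhn; rewrite -(periodic_modn i per).
  apply: (Wcell (v (i %% n), r)); rewrite ?wW//.
  by apply/allpairsP; exists (i %% n, r); rewrite mem_iota /= ltn_mod; split=> //; lia.
exact: triangle_exterior T b0 c0.
Qed.
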